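(* Let $G=GL(n;\mathbb{C})$. Define $$T\bar{C}_{0,5}=\frac{-1}{3!}\left(\frac{1}{2\pi i}\right)^3\frac{1}{10}\,\mathrm{tr}(\theta_0^5)\in\Omega^5(PG(0)),\qquad PG(0)=G,$$ $$T\bar{C}_{1,4}=\frac{-1}{3!}\left(\frac{1}{2\pi i}\right)^3\left(\frac12\mathrm{tr}(\theta_0^3\theta_1)-\frac14\mathrm{tr}(\theta_0\theta_1\theta_0\theta_1)+\frac12\mathrm{tr}(\theta_0\theta_1^3)\right)\in\Omega^4(PG(1)),$$ $$T\bar{C}_{2,3}=\frac{1}{3!}\left(\frac{1}{2\pi i}\right)^3\left(\frac12\mathrm{tr}(\theta_0\theta_1\theta_2)-\frac12\mathrm{tr}(\theta_0\theta_2\theta_1)\right)\in\Omega^3(PG(2)).$$ Then $T\bar{C}_{0,5}+T\bar{C}_{1,4}+T\bar{C}_{2,3}$ is the Chern-Simons form in $\Omega^5(PG)$ of the 3rd Chern character; that is, with $\bar{C}_{1,5}+\bar{C}_{2,4}+\bar{C}_{3,3}\in\Omega^6(PG)$ the cocycle corresponding to the 3rd Chern character, $$d''T\bar{C}_{0,5}=0,\qquad d'T\bar{C}_{0,5}+d''T\bar{C}_{1,4}=\bar{C}_{1,5},$$ $$d'T\bar{C}_{1,4}+d''T\bar{C}_{2,3}=\bar{C}_{2,4},\qquad d'T\bar{C}_{2,3}=\bar{C}_{3,3}.$$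
   Context: For a Lie group $G$, $PG$ is the simplicial manifold with $PG(q)=G^{q+1}\ni(g_0,\dots,g_q)$ and face operators $\bar{\varepsilon}_i:PG(q)\to PG(q-1)$, $\bar{\varepsilon}_i(g_0,\dots,g_q)=(g_0,\dots,g_{i-1},g_{i+1},\dots,g_q)$, $0\le i\le q$. The double complex is $\Omega^{q,r}(PG)=\Omega^r(PG(q))$ (smooth, complex-valued differential forms), with $d'=\sum_{i=0}^{q+1}(-1)^i\bar{\varepsilon}_i^*:\Omega^r(PG(q))\to\Omega^r(PG(q+1))$ and $d''=(-1)^q\times$(exterior differential) on $\Omega^r(PG(q))$; $\Omega^*(PG)$ also denotes the total complex, with differential $d'+d''$. On $PG(q)$, $\theta_i=\mathrm{pr}_i^*\bar\theta$ where $\mathrm{pr}_i:PG(q)\to G$ is the projection to the factor $g_i$ and $\bar\theta=g^{-1}dg$ is the Maurer-Cartan form of $G$ (a matrix-valued 1-form, so $d\theta_i=-\theta_i\wedge\theta_i$). Products of matrix-valued forms are matrix products using the wedge product of entries. The cocycle corresponding to the 3rd Chern character in $\Omega^6(PG)$ is $\bar{C}_{1,5}+\bar{C}_{2,4}+\bar{C}_{3,3}$ with $$\bar{C}_{1,5}=\frac{1}{3!}\left(\frac{1}{2\pi i}\right)^3\frac{1}{10}\mathrm{tr}\,(\theta_0-\theta_1)^5\in\Omega^5(PG(1)),$$ $$\bar{C}_{2,4}=\frac{-1}{3!}\left(\frac{1}{2\pi i}\right)^3\Big(\frac12\mathrm{tr}\,(\theta_0-\theta_1)^3(\theta_1-\theta_2)+\frac14\mathrm{tr}\,(\theta_0-\theta_1)(\theta_1-\theta_2)(\theta_0-\theta_1)(\theta_1-\theta_2)+\frac12\mathrm{tr}\,(\theta_0-\theta_1)(\theta_1-\theta_2)^3\Big)\in\Omega^4(PG(2)),$$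 $$\bar{C}_{3,3}=\frac{-1}{3!}\left(\frac{1}{2\pi i}\right)^3\Big(\frac12\mathrm{tr}\,(\theta_0-\theta_1)(\theta_1-\theta_2)(\theta_2-\theta_3)-\frac12\mathrm{tr}\,(\theta_0-\theta_1)(\theta_2-\theta_3)(\theta_1-\theta_2)\Big)\in\Omega^3(PG(3)).$$ A Chern-Simons form of a cocycle in $\Omega^*(PG)$ is a cochain of total degree one less whose image under $d'+d''$ is that cocycle. *)

(* Defs.v *)
From HB Require Import structures.
From mathcomp Require Import all_boot all_order all_algebra all_fingroup.
From mathcomp Require Import complex.
From mathcomp Require Import all_classical all_reals all_analysis.

Set Implicit Arguments.
Unset Strict Implicit.
Unset Printing Implicit Defensive.

Import Order.TTheory GRing.Theory Num.Theory.
Import numFieldNormedType.Exports.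

Local Open Scope classical_set_scope.
Local Open Scope ring_scope.

(* All the manifolds involved are open subsets of real vector spaces, so a
   differential form is given in the global chart: it maps a point and r tangent
   vectors to a complex number.  The type [dform V r] only carries the raw data;
   multilinearity, alternation and smoothness on the relevant open set are
   imposed by [is_form].  Values outside of that open set are meaningless, hence
   equality of forms is always stated as [{in U, omega =1 eta}]. *)
Definition dform (R : realType) (V : normedModType R) (r : nat) : Type :=
  V -> ('I_r -> V) -> R[i]^o.

HB.instance Definition _ (R : realType) (V : normedModType R) (r : nat) :=
  GRing.Lmodule.copy (dform V r) (V -> ('I_r -> V) -> R[i]^o).

Section Forms.
Context {R : realType}.
Implicit Types V W : normedModType R.

Fixpoint differentiable_upto V W (k : nat) (U : set V) (f : V -> W) : Prop :=
  if k is k'.+1 then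
    (forall x, U x -> differentiable f x) /\
    (forall v, differentiable_upto k' U (fun x => 'D_v f x))
  else True.

(* U is meant to be open and V finite-dimensional *)
Definition smooth V W (U : set V) (f : V -> W) : Prop :=
  forall k, differentiable_upto k U f.

Definition is_form V r (U : set V) (omega : dform V r) : Prop :=
  [/\ forall x, U x -> forall (v : 'I_r -> V) (i : 'I_r) (a : R) (u w : V),
        omega x [eta v with i |-> a *: u + w] =
        a%:C%C * omega x [eta v with i |-> u] + omega x [eta v with i |-> w],
      forall x, U x -> forall (v : 'I_r -> V) (i j : 'I_r),
        i != j -> v i = v j -> omega x v = 0
    & forall v : 'I_r -> V,
        smooth U (fun x => complex.Re (omega x v) : R^o) /\
        smooth U (fun x => complex.Im (omega x v) : R^o)].

Definition cderive V (f : V -> R[i]) (x v : V) : R[i] :=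
  ('D_v (fun y => complex.Re (f y) : R^o) x +i*
   'D_v (fun y => complex.Im (f y) : R^o) x)%C.

(* The invariant formula for d, on constant vector fields (whose brackets
   vanish); no factor 1/(r+1), consistently with [wedge]. *)
Definition extd V r (omega : dform V r) : dform V r.+1 := fun x v =>
  \sum_(i < r.+1)
    (-1) ^+ i * cderive (fun y => omega y (v \o lift i)) x (v i).

Definition wedge V p q (alpha : dform V p) (beta : dform V q) : dform V (p + q) :=
  fun x v => (p`! * q`!)%:R^-1 *
    \sum_(s : 'S_(p + q)) (-1) ^+ s *
      (alpha x (fun i => v (s (lshift q i))) *
       beta x (fun j => v (s (rshift p j)))).

Definition pullback V W r (f : V -> W) (omega : dform W r) : dform V r :=
  fun x v => omega (f x) (fun i => 'd f x (v i)).

Definition mxform V n r := 'M[dform V r]_n.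

Definition mxwedge V n p q (A : mxform V n p) (B : mxform V n q) :
    mxform V n (p + q) :=
  \matrix_(a, b) \sum_c wedge (A a c) (B c b).

Fixpoint mxpow V n (A : mxform V n 1) (k : nat) : mxform V n k :=
  if k is k'.+1 then mxwedge A (mxpow A k')
  else \matrix_(a, b) (fun _ _ => (a == b)%:R).

Definition trform V n r (A : mxform V n r) : dform V r := \sum_a A a a.

End Forms.

Infix "∧" := mxwedge (at level 40, left associativity).

Section SimplicialGL.
Variables (R : realType) (n : nat).

(* The real vector space underlying the m-tuples of complex n x n matrices: the
   i-th matrix has real and imaginary parts the i-th rows of the two
   components. *)
Definition tuples (m : nat) : normedModType R :=
  ('M[R]_(m, n * n) * 'M[R]_(m, n * n))%type.

Definition entry m (x : tuples m) (i : 'I_m) : 'M[R[i]]_n :=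
  \matrix_(a, b) (x.1 i (mxvec_index a b) +i* x.2 i (mxvec_index a b))%C.

(* PG(q) = G^{q+1} for G = GL(n; C) *)
Definition PGspace (q : nat) : normedModType R := tuples q.+1.

Definition PG (q : nat) : set (PGspace q) :=
  [set g | forall i, entry g i \in unitmx].
Arguments PG q : clear implicits.

Definition face q (i : 'I_q.+2) (g : PGspace q.+1) : PGspace q :=
  (row' i g.1, row' i g.2).

Definition proj q (i : 'I_q.+1) (g : PGspace q) : PGspace 0 :=
  (row i g.1, row i g.2).

(* g^-1 dg on G = PG(0), where dg is [entry], which is linear *)
Definition maurer_cartan : mxform (PGspace 0) n 1 :=
  \matrix_(a, b) (fun g v =>
    (invmx (entry g ord0) *m entry (v ord0) ord0) a b).

Definition theta q (i : 'I_q.+1) : mxform (PGspace q) n 1 :=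
  map_mx (pullback (proj i)) maurer_cartan.

Definition d' q r (omega : dform (PGspace q) r) : dform (PGspace q.+1) r :=
  \sum_(i < q.+2) (-1) ^+ i *: pullback (face i) omega.

Definition d'' q r (omega : dform (PGspace q) r) : dform (PGspace q) r.+1 :=
  (-1) ^+ q *: extd omega.

Definition cochain := forall q r : nat, dform (PGspace q) r.

Definition total_d (c : cochain) : cochain := fun q r =>
  (if q is q'.+1 return dform (PGspace q) r then d' (c q' r) else 0) +
  (if r is r'.+1 return dform (PGspace q) r then d'' (c q r') else 0).
Arguments total_d c q r : clear implicits.

Definition in_total_degree (k : nat) (c : cochain) : Prop :=
  (forall q r, is_form (PG q) (c q r)) /\
  (forall q r, (q + r)%N != k -> {in PG q, c q r =1 (0 : dform _ _)}).

(* [T], of total degree k, is a Chern-Simons form of [C], of degree k + 1 *)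
Definition is_chern_simons (k : nat) (C T : cochain) : Prop :=
  in_total_degree k T /\
  forall q r, {in PG q, total_d T q r =1 C q r}.

Definition ch3_coef : R[i] :=
  (3`!)%:R^-1 * (2 * (pi : R)%:C%C * 'i%C)^-1 ^+ 3.

Definition theta_sub q (i : nat) : mxform (PGspace q) n 1 :=
  theta (inord i) - theta (inord i.+1).

Local Notation th i := (theta (inord i)).
Local Notation tr := trform.

Definition C15 : dform (PGspace 1) 5 :=
  ch3_coef *: (10%:R^-1 *: tr (mxpow (theta_sub 1 0) 5)).

Definition C24 : dform (PGspace 2) 4 :=
  let x := theta_sub 2 0 in let y := theta_sub 2 1 in
  - ch3_coef *: (2%:R^-1 *: tr (mxpow x 3 ∧ y)
                 + 4%:R^-1 *: tr (x ∧ y ∧ x ∧ y)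
                 + 2%:R^-1 *: tr (x ∧ mxpow y 3)).

Definition C33 : dform (PGspace 3) 3 :=
  let x := theta_sub 3 0 in let y := theta_sub 3 1 in let z := theta_sub 3 2 in
  - ch3_coef *: (2%:R^-1 *: tr (x ∧ y ∧ z) - 2%:R^-1 *: tr (x ∧ z ∧ y)).

Definition TC05 : dform (PGspace 0) 5 :=
  - ch3_coef *: (10%:R^-1 *: tr (mxpow (th 0) 5)).

Definition TC14 : dform (PGspace 1) 4 :=
  - ch3_coef *: (2%:R^-1 *: tr (mxpow (th 0) 3 ∧ th 1)
                 - 4%:R^-1 *: tr (th 0 ∧ th 1 ∧ th 0 ∧ th 1)
                 + 2%:R^-1 *: tr (th 0 ∧ mxpow (th 1) 3)).

Definition TC23 : dform (PGspace 2) 3 :=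
  ch3_coef *: (2%:R^-1 *: tr (th 0 ∧ th 1 ∧ th 2)
               - 2%:R^-1 *: tr (th 0 ∧ th 2 ∧ th 1)).

Definition ch3_cocycle : cochain := fun q r =>
  match q, r return dform (PGspace q) r with
  | 1, 5 => C15
  | 2, 4 => C24
  | 3, 3 => C33
  | _, _ => 0
  end.

Definition ch3_transgression : cochain := fun q r =>
  match q, r return dform (PGspace q) r with
  | 0, 5 => TC05
  | 1, 4 => TC14
  | 2, 3 => TC23
  | _, _ => 0
  end.

End SimplicialGL.

Arguments PG : clear implicits.
Arguments theta {R n q} i.
Arguments total_d {R n} c q r.
Arguments C15 : clear implicits.
Arguments C24 : clear implicits.
Arguments C33 : clear implicits.
Arguments TC05 : clear implicits.
Arguments TC14 : clear implicits.
Arguments TC23 : clear implicits.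
Arguments ch3_cocycle : clear implicits.
Arguments ch3_transgression : clear implicits.

(* Main.v *)
From HB Require Import structures.
From mathcomp Require Import all_boot all_order all_algebra all_fingroup complex.
From mathcomp Require Import ring zify.
From mathcomp Require Import all_classical all_reals all_analysis.
Require Import Defs.

(** The identities hold already at the level of cyclic words in the letters
    theta_0, theta_1, ...  The wedge product of matrices of 1-forms A_1, ..., A_k
    is the antisymmetrisation of the matrix product, so that its value on
    (v_1, ..., v_k) is the sum over the permutations t of
    (-1)^t A_1(v_t(1)) ... A_k(v_t(k)); this is [word], and [trword] is its trace.
    Wedging words concatenates them ([word_cat]), whence all the forms of the
    theorem are linear combinations of traces of words.  On these:

    - the trace is additive in each letter, and moving the first letter of a word
      of length k + 1 to the end multiplies the trace by (-1)^k
      ([trwordB], [trword_rot]);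
    - since d(g^-1) = - g^-1 dg g^-1, one has d theta_i = - theta_i theta_i, hence
      by the Leibniz rule d tr(A_1 ... A_k) is minus the alternating sum of the
      traces of the words in which one letter is doubled ([extd_trword]);
    - face operators are linear in the chart and pull theta_j back to theta_j or
      theta_(j+1), so d' is an alternating sum of renumberings of the letters
      ([pullback_theta], [d'_wordsum]).

    Expanding the cocycle by additivity and collecting the words up to rotation
    ([cyclic5_expand], [cyclic4_expand], [cyclic3_expand]) gives the equations in
    bidegrees (1,5), (2,4) and (3,3); in bidegree (0,6) the trace of an even power
    of theta_0 equals its own opposite.

    That such T exist is no accident: the terms of the expansion of C in which the
    last letter does not occur are the pullback of C along the extra degeneracy
    (g_0, ..., g_q) |-> (g_0, ..., g_q, 1), the contraction of PG, and
    T in bidegree (q, r) is (-1)^(q+1) times this pullback of C in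
    bidegree (q + 1, r).

    It remains to see that the components of T are forms, that is multilinear,
    alternating and smooth.  The derivative of an entry of theta_i(v) along a
    constant field u is an entry of - theta_i(u) theta_i(v), hence a polynomial in
    functions of the same kind, so differentiability of these entries gives their
    smoothness at once by induction ([mc_form_csmooth]). *)

Set Implicit Arguments.
Unset Strict Implicit.
Unset Printing Implicit Defensive.
Import Order.TTheory GRing.Theory Num.Theory.
Import numFieldNormedType.Exports.
Local Open Scope classical_set_scope.
Local Open Scope ring_scope.

(** * Permutations and products of matrices *)

Section BlockPermutations.
Variables p q : nat.
Implicit Types (s : 'S_p) (t : 'S_q).

Definition block_perm_fun s t (i : 'I_(p + q)) : 'I_(p + q) :=
  unsplit (match fintype.split i with inl a => inl (s a) | inr b => inr (t b) end).

Lemma block_perm_funK s t :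
  cancel (block_perm_fun s t) (block_perm_fun s^-1%g t^-1%g).
Proof.
move=> i; rewrite /block_perm_fun unsplitK -[RHS]splitK.
by case: (fintype.split i) => a; rewrite permK.
Qed.

Definition block_perm s t : 'S_(p + q) := perm (can_inj (block_perm_funK s t)).

Lemma block_perm_lshift s t i :
  block_perm s t (lshift q i) = lshift q (s i).
Proof.
by rewrite permE /block_perm_fun -[lshift q i]/(unsplit (inl i)) unsplitK.
Qed.

Lemma block_perm_rshift s t j :
  block_perm s t (rshift p j) = rshift p (t j).
Proof.
by rewrite permE /block_perm_fun -[rshift p j]/(unsplit (inr j)) unsplitK.
Qed.

(** The determinant of a permutation matrix is the sign, and the matrix of a block
    permutation is block-diagonal. *)
Lemma sign_block_perm (K : comPzRingType) s t :
  (-1) ^+ block_perm s t = (-1) ^+ s * (-1) ^+ t :> K.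
Proof.
rewrite - !det_perm -(det_ublock _ 0); congr (\det _).
apply/matrixP => i j; rewrite -(splitK i) -(splitK j).
by case: (fintype.split i) => a; case: (fintype.split j) => b;
  rewrite /= ?block_mxEul ?block_mxEur ?block_mxEdl ?block_mxEdr !mxE
    ?block_perm_lshift ?block_perm_rshift ?eq_lshift ?eq_rshift
    ?eq_lrshift ?eq_rlshift.
Qed.

End BlockPermutations.

(** A permutation of k + 1 points amounts to the image i of j together with a
    permutation of k points; the two sides have equally many elements, so
    injectivity is enough. *)
Lemma sum_lift_perm (M : nmodType) k (j : 'I_k.+1) (f : 'S_k.+1 -> M) :
  \sum_t f t = \sum_i \sum_t f (lift_perm j i t).
Proof.
rewrite pair_bigA /= (reindex (fun p : 'I_k.+1 * 'S_k => lift_perm j p.1 p.2))//.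
apply/onW_bij/inj_card_bij => [[i t] [i' t'] /= tt'|]; last first.
  by rewrite card_prod card_ord !card_Sn factS.
have ii' : i = i' by rewrite -(lift_perm_id j i t) tt' lift_perm_id.
congr (_, _) => //; apply/permP => l; apply: (@lift_inj _ i).
by rewrite -(lift_perm_lift j) tt' lift_perm_lift ii'.
Qed.

(** Repeating the j-th entry of a sequence shifts the indices beyond j, which is
    what [unbump] undoes. *)
Lemma nth_take_drop (T : Type) (x0 : T) (s : seq T) j m : (j < size s)%N ->
  nth x0 (take j.+1 s ++ drop j s) m = nth x0 s (unbump j m).
Proof.
move=> js; rewrite nth_cat size_takel // /unbump ltnS leqNgt.
case: (ltnP j m) => jm /=.
  rewrite nth_drop; congr nth; lia.
by rewrite nth_take ?ltnS// subn0.
Qed.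

Section MultilinearAlgebra.
Variable (K : numFieldType).

(** Composing with the transposition of i and j changes the sign of each term but
    not its value. *)
Lemma alternating_eq0 (T : Type) k (f : ('I_k -> T) -> K) (v : 'I_k -> T) i j :
  i != j -> v i = v j -> \sum_(t : 'S_k) (-1) ^+ t * f (v \o t) = 0.
Proof.
move=> ij vij; apply/eqP; rewrite -eqNr -sumrN; apply/eqP.
rewrite (reindex_inj (mulIg (tperm i j))); apply: eq_bigr => t _ /=.
rewrite odd_permM odd_tperm ij signr_addb mulrN1 mulNr opprK.
congr (_ * f _); apply/funext => l /=; rewrite permM.
by case: tpermP => [->|->|].
Qed.

Lemma prod_mx_linear n k (F G H : 'I_k -> 'M[K]_n) (j : 'I_k) (a : K) :
  F j = a *: G j + H j -> (forall l, l != j -> F l = G l /\ F l = H l) ->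
  \prod_(l < k) F l = a *: \prod_(l < k) G l + \prod_(l < k) H l.
Proof.
elim: k F G H j => [|k IH] F G H j; first by case: j.
move=> Fj FGH; rewrite !big_ord_recl; case: (unliftP ord0 j) => [m|] jE.
  have [|<- <-] := FGH ord0; first by rewrite jE neq_lift.
  rewrite (IH _ (fun l => G (lift ord0 l)) (fun l => H (lift ord0 l)) m) -?jE//.
    by rewrite mulrDr; congr (_ + _); rewrite -[LHS]/(_ *m _) -scalemxAr.
  move=> l lm; apply: FGH; rewrite jE; apply: contra lm => /eqP/lift_inj ->.
  exact: eqxx.
have -> : \prod_(l < k) G (lift ord0 l) = \prod_(l < k) F (lift ord0 l).
  by apply: eq_bigr => l _; have [|->] := FGH (lift ord0 l); rewrite ?jE.
have <- : \prod_(l < k) F (lift ord0 l) = \prod_(l < k) H (lift ord0 l).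
  by apply: eq_bigr => l _; have [|_ ->] := FGH (lift ord0 l); rewrite ?jE.
by rewrite -jE Fj mulrDl; congr (_ + _); rewrite -[LHS]/(_ *m _) -scalemxAl.
Qed.

(** Matches a product of k factors, the j-th of which is itself a product of two,
    with a product of k + 1 factors: the shape in which the Leibniz rule produces
    words with a doubled letter. *)
Lemma prod_merge (M : pzRingType) k (G : 'I_k.+1 -> M) (j : 'I_k) :
  let j' := widen_ord (leqnSn k) j in
  \prod_(l < k) (if l == j then G j' * G (lift j' j) else G (lift j' l)) =
  \prod_(m < k.+1) G m.
Proof.
elim: k G j => [|k IH] G j; first by case: j.
cbv zeta; rewrite big_ord_recl [RHS]big_ord_recl.
case: (unliftP ord0 j) => [m|] jE.
  rewrite jE (negPf (neq_lift _ _)).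
  rewrite -(IH (fun i => G (lift ord0 i)) m); congr (G _ * _).
    exact: val_inj.
  apply: eq_bigr => l _; rewrite (inj_eq lift_inj).
  by case: ifP => _; [congr (G _ * G _) | congr (G _)];
    apply: val_inj; rewrite //= /bump /= ?add1n ?add0n ltnS addnS.
rewrite jE eqxx big_ord_recl mulrA; congr (_ * _).
by congr (G _ * G _); apply: val_inj.
Qed.

End MultilinearAlgebra.

(** * Words in matrices of 1-forms *)

Section Words.
Context {R : realType} {V : normedModType R} {n : nat}.
Implicit Types (A B : mxform V n 1) (s t : seq (mxform V n 1)) (x u : V).

Definition letter A x u : 'M[R[i]]_n :=
  map_mx (fun w : dform V 1 => w x (fun=> u)) A.

(** The letters are read off a sequence with default value 0, and the length k is a
    separate argument, so that the wedge of words of lengths p and q has literally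
    the type of a word of length p + q. *)
Definition word k s : mxform V n k := \matrix_(a, b) fun x v =>
  (\sum_(t : 'S_k) (-1) ^+ t *: \prod_(l < k) letter s`_l x (v (t l))) a b.

Lemma wordE k s a b x v : word k s a b x v =
  (\sum_(t : 'S_k) (-1) ^+ t *: \prod_(l < k) letter s`_l x (v (t l))) a b.
Proof. by rewrite mxE. Qed.

Definition trword k s (x : V) (v : 'I_k -> V) : R[i] := \sum_(t : 'S_k)
  (-1) ^+ t * \tr (\prod_(l < k) letter s`_l x (v (t l))).
Arguments trword : clear implicits.

Lemma sum_dformE (I : Type) (r : seq I) (P : pred I) k (f : I -> dform V k)
    x (v : 'I_k -> V) :
  (\sum_(i <- r | P i) f i) x v = \sum_(i <- r | P i) f i x v.
Proof.
by elim/big_rec2: _ => // i a b _ <-.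
Qed.

Lemma trform_word k s : trform (word k s) = trword k s.
Proof.
apply/funext => x; apply/funext => v; rewrite /trform sum_dformE /trword.
under eq_bigr do rewrite mxE summxE.
rewrite exchange_big; apply: eq_bigr => t _.
by rewrite /mxtrace mulr_sumr; apply: eq_bigr => a _; rewrite mxE.
Qed.

(** Both factors are already antisymmetrised, so each of the p! q! pairs of
    permutations contributes the same amount, which cancels the normalisation of
    the wedge product. *)
Lemma word_cat p q s t : size s = p ->
  mxwedge (word p s) (word q t) = word (p + q) (s ++ t).
Proof.
move=> sp; apply/matrixP => a b; apply/funext => x; apply/funext => v.
rewrite !mxE sum_dformE /wedge.
set P := fun r : 'S_(p + q) =>
  \prod_(l < p + q) letter (s ++ t)`_l x (v (r l)).
have PE (r : 'S_(p + q)) : P r =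
   (\prod_(l < p) letter s`_l x (v (r (lshift q l)))) *m
   (\prod_(l < q) letter t`_l x (v (r (rshift p l)))).
  rewrite /P big_split_ord /=; congr (_ *m _); apply: eq_bigr => l _ /=.
    by rewrite nth_cat sp ltn_ord.
  by rewrite nth_cat sp ltnNge leq_addr addKn.
transitivity ((p`! * q`!)%:R^-1 * \sum_(c : 'S_p) \sum_(d : 'S_q)
   \sum_(r : 'S_(p + q)) (-1) ^+ r * P r a b).
  rewrite -mulr_sumr; congr (_ * _).
  rewrite exchange_big /=.
  under [RHS]eq_bigr => c _ do under eq_bigr => d _ do
    rewrite (reindex_inj (mulgI (block_perm c d))) /=.
  under [RHS]eq_bigr => c _ do rewrite exchange_big /=.
  rewrite [RHS]exchange_big; apply: eq_bigr => r _ /=.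
  rewrite -mulr_sumr; under [X in _ * X]eq_bigr do
    rewrite !wordE !summxE big_distrlr /=.
  rewrite exchange_big mulr_sumr; apply: eq_bigr => c _ /=.
  rewrite exchange_big mulr_sumr; apply: eq_bigr => d _ /=.
  rewrite PE.
  under [X in (X *m _) _ _]eq_bigr do rewrite permM block_perm_lshift.
  under [X in (_ *m X) _ _]eq_bigr do rewrite permM block_perm_rshift.
  rewrite mxE !mulr_sumr; apply: eq_bigr => e _ /=.
  by rewrite ![in LHS]mxE odd_permM signr_addb sign_block_perm
     mulrACA [LHS]mulrA [(-1) ^+ r * _]mulrC.
rewrite !sumr_const !card_Sn -mulrnA mulnC -[X in _ * X = _]mulr_natl mulKf; last first.
  by rewrite pnatr_eq0 muln_eq0 negb_or -!lt0n !fact_gt0.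
by rewrite summxE; apply: eq_bigr => r _; rewrite [RHS]mxE.
Qed.

Lemma word1 A : A = word 1 [:: A].
Proof.
apply/matrixP => a b; apply/funext => x; apply/funext => v; rewrite wordE.
rewrite (big_pred1 1%g) => [|t]; last first.
  by rewrite [t]permS1 /= eqxx.
rewrite odd_perm1 scale1r big_ord1 mxE perm1 /=; congr (A a b x).
by apply/funext => i; rewrite ord1.
Qed.

(** The cyclic permutation of k + 1 points has sign (-1)^k, and the trace of a
    product of two matrices does not depend on their order. *)
Lemma trword_rot k s A x v : size s = k ->
  trword k.+1 (A :: s) x v = (-1) ^+ k * trword k.+1 (rcons s A) x v.
Proof.
move=> sk; rewrite /trword (reindex_inj (mulgI (lift_perm ord0 ord_max 1%g))).
rewrite mulr_sumr; apply: eq_bigr => t _ /=.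
rewrite odd_permM signr_addb odd_lift_perm odd_perm1 addbF /= signr_odd.
rewrite -mulrA; congr (_ * (_ * _)).
rewrite big_ord_recl big_ord_recr /= nth_rcons sk ltnn eqxx.
rewrite permM lift_perm_id -[LHS]mxtrace_mulC; congr (\tr (_ *m _)).
apply: eq_bigr => l _; rewrite permM lift_perm_lift perm1 /=.
rewrite nth_rcons sk ltn_ord; congr (letter _ _ (v (t _))).
by apply: val_inj; rewrite /= /bump leqNgt ltn_ord.
Qed.

Lemma letterB A B x u : letter (A - B) x u = letter A x u - letter B x u.
Proof. by apply/matrixP => a b; rewrite !mxE. Qed.

Lemma trwordB k A B s x v : trword k.+1 (A - B :: s) x v =
  trword k.+1 (A :: s) x v - trword k.+1 (B :: s) x v.
Proof.
rewrite /trword -sumrB; apply: eq_bigr => t _.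
by rewrite -mulrBr !big_ord_recl /= letterB mulrBl linearB.
Qed.

End Words.
Arguments trword {R V n} k s x v.

(** * Derivatives of complex-valued and matrix-valued functions *)

Section Calculus.
Context {R : realType} {V : normedModType R}.
Implicit Types (f g : V -> R[i]) (x u : V) (U : set V).

(** The zero map satisfies the defining expansion of the differential. *)
Lemma near0_differentiable (W : normedModType R) (e : V -> W) x :
  (\near x, e x = 0) -> differentiable e x.
Proof.
move=> e0; pose z : {linear V -> W} := \0%R.
have de : e \o shift x = cst (e x) + (z : V -> W) +o_ 0 id.
  apply/eqaddoP => _/posnumP[eps]; near=> y.
  rewrite !fctE /= (nbhs_singleton e0) !addr0 subr0.
  have -> : e (y + x) = 0.
    by near: y; move: e0; rewrite (near_shift 0) subr0.
  by rewrite normr0 mulr_ge0.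
have zc : continuous z by move=> ?; exact: cst_continuous.
by apply/diff_locallyP; rewrite (diff_unique zc de).
Unshelve. all: by end_near. Qed.

Lemma near_eq_differentiable (W : normedModType R) (f g : V -> W) x :
  (\near x, f x = g x) -> differentiable f x -> differentiable g x.
Proof.
move=> fg df; rewrite (_ : g = f + (g - f)); last by rewrite addrC subrK.
apply: differentiableD => //; apply: near0_differentiable.
near=> y; have fgy : f y = g y by near: y.
by rewrite -[LHS]/(g y - f y) fgy subrr.
Unshelve. all: by end_near. Qed.

(** Differentiability over the reals: the complex numbers are seen as a plane. *)
Definition cdifferentiable f x :=
  differentiable (fun y => complex.Re (f y) : R^o) x /\
  differentiable (fun y => complex.Im (f y) : R^o) x.

Definition has_cderive f x (D : V -> R[i]) :=
  cdifferentiable f x /\ forall u, cderive f x u = D u.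

Lemma cdifferentiableP f x :
  cdifferentiable f x -> has_cderive f x (cderive f x).
Proof. by []. Qed.

Lemma has_cderive_cst (c : R[i]) x : has_cderive (fun=> c) x (fun=> 0).
Proof.
split=> [|u]; first by split; exact: differentiable_cst.
by rewrite /cderive !derive_cst.
Qed.

Lemma near_eq_has_cderive f g x D : (\near x, f x = g x) ->
  has_cderive f x D -> has_cderive g x D.
Proof.
move=> fg [[rf jf] Df].
have rE : \near x, (complex.Re (f x) : R^o) = complex.Re (g x).
  by near do congr (complex.Re _); exact: fg.
have jE : \near x, (complex.Im (f x) : R^o) = complex.Im (g x).
  by near do congr (complex.Im _); exact: fg.
split=> [|u].
  by split; [exact: near_eq_differentiable rf | exact: near_eq_differentiable jf].
by rewrite -Df /cderive (near_eq_derive _ rE) (near_eq_derive _ jE).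
Unshelve. all: by end_near. Qed.

Lemma eq_has_cderive f x D D' :
  D =1 D' -> has_cderive f x D -> has_cderive f x D'.
Proof. by move=> DD' [df Df]; split=> // u; rewrite Df DD'. Qed.

Lemma has_cderiveD f g x Df Dg : has_cderive f x Df -> has_cderive g x Dg ->
  has_cderive (fun y => f y + g y) x (fun u => Df u + Dg u).
Proof.
move=> [[rf jf] Df'] [[rg jg] Dg'].
have rE : (fun y => complex.Re (f y + g y) : R^o) =
    (fun y => complex.Re (f y)) + (fun y => complex.Re (g y)).
  by apply/funext => y; rewrite raddfD.
have jE : (fun y => complex.Im (f y + g y) : R^o) =
    (fun y => complex.Im (f y)) + (fun y => complex.Im (g y)).
  by apply/funext => y; rewrite raddfD.
split=> [|u]; first by split; rewrite ?rE ?jE; exact: differentiableD.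
rewrite -Df' -Dg' /cderive rE jE !deriveD//; exact: diff_derivable.
Qed.

Lemma has_cderiveM f g x Df Dg : has_cderive f x Df -> has_cderive g x Dg ->
  has_cderive (fun y => f y * g y) x (fun u => Df u * g x + f x * Dg u).
Proof.
move=> [[rf jf] Df'] [[rg jg] Dg'].
have rE : (fun y => complex.Re (f y * g y) : R^o) =
    (fun y => complex.Re (f y)) * (fun y => complex.Re (g y)) -
    (fun y => complex.Im (f y)) * (fun y => complex.Im (g y)).
  by apply/funext => y; rewrite !fctE; case: (f y) (g y) => [? ?] [? ?].
have jE : (fun y => complex.Im (f y * g y) : R^o) =
    (fun y => complex.Re (f y)) * (fun y => complex.Im (g y)) +
    (fun y => complex.Im (f y)) * (fun y => complex.Re (g y)).
  by apply/funext => y; rewrite !fctE; case: (f y) (g y) => [? ?] [? ?].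
split=> [|u].
  by split; rewrite ?rE ?jE; [apply: differentiableB | apply: differentiableD];
    exact: differentiableM.
have dv h : differentiable h x -> derivable (h : V -> R^o) x u.
  exact: diff_derivable.
rewrite -Df' -Dg' /cderive rE jE deriveB ?deriveD; try exact/dv/differentiableM.
rewrite !deriveM; try exact: dv.
case: (f x) (g x) => [a b] [c d] /=.
have ZE (r t : R) : r *: (t : R^o) = r * t by [].
by apply/eqP; rewrite eq_complex /= !ZE; apply/andP; split; apply/eqP; ring.
Qed.

(** 1 / z is the conjugate of z divided by the squared modulus N. *)
Lemma cdifferentiableV f x : cdifferentiable f x -> f x != 0 ->
  cdifferentiable (fun y => (f y)^-1) x.
Proof.
move=> [rf jf] fx0.
pose N := (fun y => complex.Re (f y)) ^+ 2 + (fun y => complex.Im (f y)) ^+ 2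
  : V -> R^o.
have dN : differentiable N x.
  by apply: differentiableD; apply: differentiableX.
have N0 : N x != 0.
  apply: contra fx0; rewrite /N !fctE; case: (f x) => a b /=.
  by rewrite paddr_eq0 ?sqr_ge0// !sqrf_eq0 eq_complex.
have dNV := differentiableV dN N0.
split.
  rewrite (_ : (fun _ => _) = (fun y => complex.Re (f y)) * (fun y => (N y)^-1)).
    exact: differentiableM.
  by apply/funext => y; rewrite /N !fctE; case: (f y) => a b /=.
rewrite (_ : (fun _ => _) = - ((fun y => complex.Im (f y)) * (fun y => (N y)^-1))).
  by apply/differentiableN/differentiableM.
apply/funext => y; rewrite /N !fctE; by case: (f y) => a b /=; rewrite ?mulNr.
Qed.

Lemma has_cderive_sum (I : finType) (P : pred I) (f : I -> V -> R[i])
    (D : I -> V -> R[i]) x :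
  (forall i, P i -> has_cderive (f i) x (D i)) ->
  has_cderive (fun y => \sum_(i | P i) f i y) x (fun u => \sum_(i | P i) D i u).
Proof.
move=> df.
have Er (g : I -> V -> R[i]) : (fun y => \sum_(i | P i) g i y) =
    \sum_(i | P i) g i.
  by apply/funext => y; rewrite fct_sumE.
rewrite !Er.
elim/big_rec2: _ => [|i g Dg Pi]; first exact: has_cderive_cst.
exact/has_cderiveD/df.
Qed.

Lemma cdifferentiableM f g x :
  cdifferentiable f x -> cdifferentiable g x ->
  cdifferentiable (fun y => f y * g y) x.
Proof. by move=> df dg; have [] := has_cderiveM (conj df (frefl _)) (conj dg (frefl _)). Qed.

Lemma cdifferentiable_sum (I : finType) (P : pred I) (f : I -> V -> R[i]) x :
  (forall i, P i -> cdifferentiable (f i) x) ->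
  cdifferentiable (fun y => \sum_(i | P i) f i y) x.
Proof.
by move=> df; have [] := has_cderive_sum (fun i Pi => conj (df i Pi) (frefl _)).
Qed.

Lemma cdifferentiable_prod (I : finType) (P : pred I) (f : I -> V -> R[i]) x :
  (forall i, P i -> cdifferentiable (f i) x) ->
  cdifferentiable (fun y => \prod_(i | P i) f i y) x.
Proof.
move=> df; rewrite (_ : (fun _ => _) = \prod_(i | P i) f i); last first.
  by apply/funext => y; rewrite fct_prodE.
elim/big_rec: _ => [|i g Pi dg]; first by have [] := has_cderive_cst 1 x.
exact: cdifferentiableM (df i Pi) dg.
Qed.

Section MatrixCalculus.
Variable n : nat.
Implicit Types (F G : V -> 'M[R[i]]_n).

Definition has_mxderive F x (D : V -> 'M[R[i]]_n) :=
  forall a b, has_cderive (fun y => F y a b) x (fun u => D u a b).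

Lemma has_mxderiveM F G x DF DG :
  has_mxderive F x DF -> has_mxderive G x DG ->
  has_mxderive (fun y => F y *m G y) x (fun u => DF u *m G x + F x *m DG u).
Proof.
move=> dF dG a b.
have -> : (fun y => (F y *m G y) a b) = (fun y => \sum_c F y a c * G y c b).
  by apply/funext => y; rewrite mxE.
apply: eq_has_cderive; last first.
  by apply: has_cderive_sum => c _; exact: has_cderiveM (dF a c) (dG c b).
by move=> u /=; rewrite !mxE -big_split.
Qed.

Lemma has_mxderive_prod k (F D : 'I_k -> V -> 'M[R[i]]_n) x :
  (forall l, has_mxderive (F l) x (D l)) ->
  has_mxderive (fun y => \prod_(l < k) F l y) x
    (fun u => \sum_j \prod_(l < k) (if l == j then D j u else F l x)).
Proof.
elim: k F D => [|k IH] F D dF.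
  move=> a b; apply: eq_has_cderive; last first.
    under eq_fun do rewrite big_ord0; exact: has_cderive_cst.
  by move=> u; rewrite big_ord0 mxE.
have -> : (fun y => \prod_(l < k.+1) F l y) =
    (fun y => F ord0 y *m \prod_(l < k) F (lift ord0 l) y).
  by apply/funext => y; rewrite big_ord_recl.
move=> a b; apply: eq_has_cderive; last first.
  exact: (has_mxderiveM (dF ord0) (IH _ _ (fun l => dF (lift ord0 l)))).
move=> u /=; rewrite big_ord_recl big_ord_recl eqxx /=.
congr (fun_of_matrix (_ *m _ + _) a b); rewrite mulmx_sumr.
by apply: eq_bigr => j _; rewrite big_ord_recl.
Qed.

Lemma has_cderive_mxtrace (F D : V -> 'M[R[i]]_n) x : has_mxderive F x D ->
  has_cderive (fun y => \tr (F y)) x (fun u => \tr (D u)).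
Proof. by move=> dF; apply: has_cderive_sum => a _; exact: dF. Qed.

Lemma cdifferentiable_det m (F : V -> 'M[R[i]]_m) x :
  (forall a b, cdifferentiable (fun y => F y a b) x) ->
  cdifferentiable (fun y => \det (F y)) x.
Proof.
move=> dF; rewrite /determinant.
apply: cdifferentiable_sum => s _; apply: cdifferentiableM.
  exact: (has_cderive_cst _ _).1.
by apply: cdifferentiable_prod => i _; exact: dF.
Qed.

(** Differentiability comes from Cramer's rule; the value of the derivative comes
    from differentiating F^-1 F = 1. *)
Lemma has_mxderive_inv F x D : has_mxderive F x D ->
  (\near x, F x \in unitmx) ->
  has_mxderive (fun y => invmx (F y)) x
    (fun u => - (invmx (F x) *m D u *m invmx (F x))).
Proof.
move=> dF Fu; have Fx := nbhs_singleton Fu.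
have dI a b : cdifferentiable (fun y => invmx (F y) a b) x.
  suff: cdifferentiable (fun y => (\det (F y))^-1 * cofactor (F y) b a) x.
    move=> /cdifferentiableP d; apply: (near_eq_has_cderive _ d).1.
    by near=> y; rewrite /invmx ifT ?mxE//; near: y.
  have dd : cdifferentiable (fun y => (\det (F y))^-1) x.
    apply: cdifferentiableV; last by rewrite -unitfE.
    by apply: cdifferentiable_det => c d; have [] := dF c d.
  apply: cdifferentiableM => //; apply: cdifferentiableM.
    exact: (has_cderive_cst _ _).1.
  apply: cdifferentiable_det => c d.
  under eq_fun do rewrite !mxE; exact: (dF _ _).1.
pose DI u := \matrix_(a, b) cderive (fun y => invmx (F y) a b) x u.
have dIF : has_mxderive (fun y => invmx (F y)) x DI.
  move=> a b; apply: eq_has_cderive (cdifferentiableP (dI a b)) => u.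
  by rewrite mxE.
suff DIE u : DI u = - (invmx (F x) *m D u *m invmx (F x)).
  by move=> a b; apply: eq_has_cderive (dIF a b) => u; rewrite DIE.
suff /eqP : DI u *m F x + invmx (F x) *m D u = 0.
  by rewrite addr_eq0 => /eqP /(congr1 (mulmxr (invmx (F x)))) /=; rewrite mulmxK// mulNmx.
apply/matrixP => a b.
have [_ /(_ u) <-] := has_mxderiveM dIF dF a b.
have near1 : \near x, (1%:M : 'M[R[i]]_n) a b = (invmx (F x) *m F x) a b.
  by near=> y; rewrite mulVmx//; near: y.
by rewrite (near_eq_has_cderive near1 (has_cderive_cst _ _)).2 mxE.
Unshelve. all: by end_near. Qed.

End MatrixCalculus.
End Calculus.

(** * Smoothness and exterior derivative of traces of words *)

Section Smoothness.
Context {R : realType} {V : normedModType R}.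
Variable U : set V.
Hypothesis openU : open U.
Implicit Types (f g : V -> R[i]) (x u : V).

Lemma near_open x (P : set V) : U x -> (forall y, U y -> P y) -> \near x, P x.
Proof.
move=> Ux UP; have := openU; rewrite openE => /(_ _ Ux) /= Un.
by apply: filterS Un.
Qed.

Definition csmooth_upto k f :=
  differentiable_upto k U (fun y => complex.Re (f y) : R^o) /\
  differentiable_upto k U (fun y => complex.Im (f y) : R^o).

(** Unfolds the recursion in [differentiable_upto] for the real and the imaginary
    part simultaneously, so that complex rules of differentiation apply. *)
Lemma csmooth_uptoS k f : csmooth_upto k.+1 f <->
  (forall x, U x -> cdifferentiable f x) /\
  (forall u, csmooth_upto k (fun x => cderive f x u)).
Proof.
split=> [[[rf rDf] [jf jDf]]|[df Df]].
  by split=> [x Ux|u]; split; [exact: rf|exact: jf|exact: rDf|exact: jDf].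
by split; split=> [x Ux|u]; [exact: (df x Ux).1|exact: (Df u).1
                            |exact: (df x Ux).2|exact: (Df u).2].
Qed.

Lemma csmooth_uptoW k f : csmooth_upto k.+1 f -> csmooth_upto k f.
Proof.
elim: k f => [//|k IH] f /csmooth_uptoS [df Df].
by apply/csmooth_uptoS; split=> // u; exact: IH.
Qed.

(** Openness of U makes equality on U an equality of germs; the derivatives of the
    explicit formulas below are only known on U. *)
Lemma eq_csmooth_upto k f g :
  (forall x, U x -> f x = g x) -> csmooth_upto k f -> csmooth_upto k g.
Proof.
elim: k f g => [//|k IH] f g fg /csmooth_uptoS [df Df].
have nfg x : U x -> has_cderive g x (cderive f x).
  move=> Ux; apply: near_eq_has_cderive (cdifferentiableP (df x Ux)).
  exact: near_open fg.
apply/csmooth_uptoS; split=> [x /nfg[]//|u].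
by apply: IH (Df u) => x /nfg[_ ->].
Qed.

Lemma csmooth_upto_step k f (D : V -> V -> R[i]) :
  (forall x, U x -> has_cderive f x (D x)) ->
  (forall u, csmooth_upto k (fun x => D x u)) -> csmooth_upto k.+1 f.
Proof.
move=> df sD; apply/csmooth_uptoS; split=> [x /df[]//|u].
by apply: eq_csmooth_upto (sD u) => x /df[_ ->].
Qed.

Lemma csmooth_upto_cst k (c : R[i]) : csmooth_upto k (fun=> c).
Proof.
elim: k c => [//|k IH] c.
exact: csmooth_upto_step (fun x _ => has_cderive_cst c x) (fun _ => IH 0).
Qed.

Lemma csmooth_uptoD k f g : csmooth_upto k f -> csmooth_upto k g ->
  csmooth_upto k (fun x => f x + g x).
Proof.
elim: k f g => [//|k IH] f g /csmooth_uptoS[df Df] /csmooth_uptoS[dg Dg].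
apply: csmooth_upto_step => [x Ux|u].
  exact: (has_cderiveD (cdifferentiableP (df x Ux)) (cdifferentiableP (dg x Ux))).
exact: IH.
Qed.

Lemma csmooth_uptoM k f g : csmooth_upto k f -> csmooth_upto k g ->
  csmooth_upto k (fun x => f x * g x).
Proof.
elim: k f g => [//|k IH] f g sf sg.
have [[df Df] [dg Dg]] := (iffLR (csmooth_uptoS _ _) sf,
                           iffLR (csmooth_uptoS _ _) sg).
apply: csmooth_upto_step => [x Ux|u].
  exact: (has_cderiveM (cdifferentiableP (df x Ux)) (cdifferentiableP (dg x Ux))).
by apply: csmooth_uptoD; apply: IH => //; exact: csmooth_uptoW.
Qed.

Lemma csmooth_upto_sum k (I : finType) (P : pred I) (f : I -> V -> R[i]) :
  (forall i, P i -> csmooth_upto k (f i)) ->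
  csmooth_upto k (fun x => \sum_(i | P i) f i x).
Proof.
move=> sf; rewrite (_ : (fun _ => _) = \sum_(i | P i) f i); last first.
  by apply/funext => y; rewrite fct_sumE.
elim/big_rec: _ => [|i g Pi sg]; first exact: csmooth_upto_cst.
exact: csmooth_uptoD (sf i Pi) sg.
Qed.

Lemma csmooth_upto_prod_mx n k m (F : 'I_m -> V -> 'M[R[i]]_n) :
  (forall l a b, csmooth_upto k (fun x => F l x a b)) ->
  forall a b, csmooth_upto k (fun x => (\prod_(l < m) F l x) a b).
Proof.
elim: m F => [|m IH] F sF a b.
  by under eq_fun do rewrite big_ord0; exact: csmooth_upto_cst.
under eq_fun do rewrite big_ord_recl mxE.
by apply: csmooth_upto_sum => c _; apply: csmooth_uptoM => //; exact: IH.
Qed.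

End Smoothness.

Section MaurerCartanForms.
Context {R : realType} {V : normedModType R} {n : nat}.
Variable U : set V.
Hypothesis openU : open U.
Implicit Types (A B : mxform V n 1) (s : seq (mxform V n 1)) (x u v w : V).

(** Pointwise linearity, and a refinement of d A = - A A: the derivative along
    the constant field u of the contraction of A with the constant field v is
    - A(u) A(v).  Antisymmetrising in u and v gives the usual structure equation;
    the form stated here determines all partial derivatives of A. *)
Definition mc_form A :=
  (forall x, U x -> forall (c : R) u w,
     letter A x (c *: u + w) = c%:C%C *: letter A x u + letter A x w) /\
  (forall x, U x -> forall v, has_mxderive (letter A ^~ v) x
     (fun u => - (letter A x u *m letter A x v))).

(** The partial derivatives of the entries are polynomials in entries of the same
    kind, so one more derivative is gained at each step of the induction. *)
Lemma mc_form_csmooth k A v a b : mc_form A ->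
  csmooth_upto U k (fun x => letter A x v a b).
Proof.
move=> [_ dA]; elim: k v a b => [//|k IH] v a b.
apply: csmooth_upto_step => // [x Ux|u]; first exact: dA.
under eq_fun do rewrite !mxE -mulN1r.
apply: csmooth_uptoM => //; first exact: csmooth_upto_cst.
by apply: csmooth_upto_sum => // c _; exact: csmooth_uptoM.
Qed.

Lemma csmooth_trword m k s (v : 'I_k -> V) :
  (forall l : 'I_k, mc_form s`_l) -> csmooth_upto U m (fun x => trword k s x v).
Proof.
move=> sA; apply: csmooth_upto_sum => // t _; apply: csmooth_uptoM => //.
  exact: csmooth_upto_cst.
apply: csmooth_upto_sum => // a _; apply: csmooth_upto_prod_mx => // l b c.
exact: mc_form_csmooth.
Qed.

Lemma is_formP r (omega : dform V r) :
  (forall x, U x -> forall (v : 'I_r -> V) (i : 'I_r) (a : R) (u w : V),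
     omega x [eta v with i |-> a *: u + w] =
     a%:C%C * omega x [eta v with i |-> u] + omega x [eta v with i |-> w]) ->
  (forall x, U x -> forall (v : 'I_r -> V) (i j : 'I_r),
     i != j -> v i = v j -> omega x v = 0) ->
  (forall m (v : 'I_r -> V), csmooth_upto U m (omega ^~ v)) -> is_form U omega.
Proof.
by move=> lin alt sm; split=> // v; split=> m; have [] := sm m v.
Qed.

Lemma is_form_trword k s :
  (forall l : 'I_k, mc_form s`_l) -> is_form U (trword k s).
Proof.
move=> sA; apply: is_formP.
- move=> x Ux v i a u w; rewrite /trword mulr_sumr -big_split.
  apply: eq_bigr => t _ /=; rewrite mulrCA -mulrDr; congr (_ * _).
  rewrite -mxtraceZ -mxtraceD; congr (\tr _).
  apply: (@prod_mx_linear _ _ _ _ _ _ (t^-1 i)%g).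
    by rewrite /= permKV eqxx (sA _).1.
  by move=> l lt; rewrite /= (canF_eq (permK t)) (negPf lt).
- move=> x Ux v i j ij vij; exact: (alternating_eq0
    (fun w : 'I_k -> V => \tr (\prod_(l < k) letter s`_l x (w l))) ij vij).
- by move=> m v; exact: csmooth_trword.
Qed.

Lemma is_form0 r : is_form U (0 : dform V r).
Proof.
apply: is_formP => [x _ v i a u w|//|m v].
  by rewrite -[LHS]/0 -[RHS]/(_ * 0 + 0) mulr0 addr0.
exact: csmooth_upto_cst.
Qed.

Lemma is_form_lin r (c : R[i]) (omega eta : dform V r) :
  is_form U omega -> is_form U eta -> is_form U (c *: omega + eta).
Proof.
move=> [lo ao so] [le ae se]; apply: is_formP.
- move=> x Ux v i a u w; rewrite -![LHS]/(_ * omega _ _ + eta _ _) lo// le//.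
  rewrite -[RHS]/(_ * (c * omega _ _ + eta _ _) + (c * omega _ _ + eta _ _)).
  ring.
- move=> x Ux v i j ij vij; rewrite -[LHS]/(c * omega x v + eta x v).
  by rewrite (ao _ Ux _ _ _ ij vij) (ae _ Ux _ _ _ ij vij) mulr0 addr0.
- move=> m v; apply: csmooth_uptoD => //.
    apply: csmooth_uptoM => //; first exact: csmooth_upto_cst.
    by split; [exact: (so v).1 | exact: (so v).2].
  by split; [exact: (se v).1 | exact: (se v).2].
Qed.

(** The derivative along the i-th vector of the j-th letter of a word replaces that
    letter A(v) by - A(v_i) A(v).  Inserting v_i at place j turns the permutation t
    into [lift_perm j i t], whose sign is (-1)^(i+j) times that of t; hence the sign
    (-1)^i in the definition of [extd] becomes (-1)^j. *)
Lemma extd_trword k s x (v : 'I_k.+1 -> V) : U x -> size s = k ->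
  (forall l : 'I_k, mc_form s`_l) ->
  extd (trword k s) x v =
    - \sum_(j < k) (-1) ^+ j * trword k.+1 (take j.+1 s ++ drop j s) x v.
Proof.
move=> Ux sk sA.
pose G i (t : 'S_k) (j : 'I_k) (m : 'I_k.+1) :=
  letter (take j.+1 s ++ drop j s)`_m x
    (v (lift_perm (widen_ord (leqnSn k) j) i t m)).
have Gj i t (j : 'I_k) : G i t j (widen_ord (leqnSn k) j) = letter s`_j x (v i).
  rewrite /G lift_perm_id nth_take_drop ?sk//; congr (letter s`_ _ x _).
  by rewrite /unbump ltnn subn0.
have GL i t (j l : 'I_k) : G i t j (lift (widen_ord (leqnSn k) j) l) =
    letter s`_l x (v (lift i (t l))).
  by rewrite /G lift_perm_lift nth_take_drop ?sk//= bumpK.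
have DE i : cderive (fun y => trword k s y (v \o lift i)) x (v i) =
    \sum_(t : 'S_k) (-1) ^+ t * \sum_j - \tr (\prod_m G i t j m).
  have dA l u := (sA l).2 x Ux u.
  have dt (t : 'S_k) : has_cderive
      (fun y => (-1) ^+ t * \tr (\prod_(l < k) letter s`_l y (v (lift i (t l)))))
      x (fun u => 0 * \tr (\prod_(l < k) letter s`_l x (v (lift i (t l)))) +
        (-1) ^+ t * \tr (\sum_j \prod_(l < k)
          if l == j then - (letter s`_j x u *m letter s`_j x (v (lift i (t j))))
          else letter s`_l x (v (lift i (t l))))).
    apply: (has_cderiveM (has_cderive_cst _ _)); apply: has_cderive_mxtrace.
    exact: (has_mxderive_prod (fun l => dA l (v (lift i (t l))))).
  rewrite (has_cderive_sum (fun (t : 'S_k) _ => dt t)).2; apply: eq_bigr => t _ /=.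
  rewrite mul0r add0r; congr (_ * _); rewrite raddf_sum; apply: eq_bigr => j _ /=.
  rewrite -(prod_merge (G i t j) j) -[RHS]linearN; congr (\tr _).
  pose P l := if l == j then letter s`_j x (v i) *m letter s`_j x (v (lift i (t j)))
          else letter s`_l x (v (lift i (t l))).
  (* the j-th factors are opposite to each other: - X = -2 X + X *)
  rewrite (@prod_mx_linear _ _ _ _ P P j (- 2)) /P.
  - rewrite scaleNr scaler_nat mulr2n opprD subrK; congr (- _).
    by apply: eq_bigr => l _; rewrite Gj !GL.
  - by rewrite eqxx scaleNr scaler_nat mulr2n opprD subrK.
  - by move=> l /negPf ->.
rewrite /extd; under eq_bigr do rewrite DE.
rewrite -sumrN.
transitivity (\sum_(j < k) \sum_(i < k.+1) \sum_(t : 'S_k)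
   (-1) ^+ i * ((-1) ^+ t * - \tr (\prod_m G i t j m))).
  rewrite exchange_big; apply: eq_bigr => i _; rewrite mulr_sumr exchange_big.
  by apply: eq_bigr => t _; rewrite !mulr_sumr.
apply: eq_bigr => j _; rewrite /trword.
rewrite (sum_lift_perm (widen_ord (leqnSn k) j)) mulr_sumr -sumrN.
apply: eq_bigr => i _; rewrite mulr_sumr -sumrN; apply: eq_bigr => t _.
rewrite odd_lift_perm signr_addb [(-1) ^+ (odd _ (+) _)]signr_addb !signr_odd.
by rewrite /= !mulrN !mulrA -expr2 sqrr_sign mul1r.
Qed.

End MaurerCartanForms.

(** * Maurer-Cartan forms on the simplicial general linear group *)

Section SimplicialForms.
Context {R : realType} {n : nat}.

Lemma entry_is_linear m (i : 'I_m) (c : R) (u w : tuples R n m) :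
  entry (c *: u + w) i = c%:C%C *: entry u i + entry w i.
Proof.
apply/matrixP => a b; rewrite /entry !mxE.
by apply/eqP; rewrite eq_complex /= !mul0r subr0 addr0 !eqxx.
Qed.

(** Faces and projections select rows in the chart, so they are linear, and they are
    continuous because the matrix norm is the maximum norm. *)
Lemma diff_mxsub q q' (f : 'I_q' -> 'I_q) (x u : tuples R n q) :
  'd (fun g : tuples R n q => (rowsub f g.1, rowsub f g.2) : tuples R n q') x u =
  (rowsub f u.1, rowsub f u.2).
Proof.
pose h (g : tuples R n q) : tuples R n q' := (rowsub f g.1, rowsub f g.2).
have hlin : linear h.
  move=> c [u1 u2] [w1 w2]; rewrite /h /=.
  by congr (_, _); apply/matrixP => a b; rewrite !mxE.
pose h' : {linear tuples R n q -> tuples R n q'} :=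
  HB.pack h (GRing.isLinear.Build _ _ _ _ h hlin).
suff hc : continuous h' by rewrite -[LHS]/('d h' x u) (diff_lin _ hc).
have rc : continuous (rowsub f : 'M[R]_(q, n * n) -> 'M[R]_(q', n * n)).
  move=> M A /nbhs_ballP [e e0 MA]; apply/nbhs_ballP; exists e => // N [_ MN].
  by apply: MA; split=> // a b; rewrite !mxE; exact: MN.
move=> [M N].
apply: (@cvg_pair _ _ _ (nbhs (M, N)) (nbhs (rowsub f M)) (nbhs (rowsub f N))
  _ _ _ (rowsub f \o fst) (rowsub f \o snd)).
  exact: cvg_comp (@cvg_fst _ _ (nbhs M) (nbhs N) _) (rc M).
exact: cvg_comp (@cvg_snd _ _ (nbhs M) (nbhs N) _) (rc N).
Qed.

Lemma diff_face q (i : 'I_q.+2) (x u : PGspace R n q.+1) :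
  'd (face i) x u = face i u.
Proof. exact: (diff_mxsub (lift i)). Qed.

Lemma diff_proj q (i : 'I_q.+1) (x u : PGspace R n q) :
  'd (proj i) x u = proj i u.
Proof. exact: (diff_mxsub (fun=> i)). Qed.

Lemma entry_face q (i : 'I_q.+2) (x : PGspace R n q.+1) (j : 'I_q.+1) :
  entry (face i x) j = entry x (lift i j).
Proof. by apply/matrixP => a b; rewrite /entry !mxE. Qed.

Lemma entry_proj q (i : 'I_q.+1) (x : PGspace R n q) :
  entry (proj i x) ord0 = entry x i.
Proof. by apply/matrixP => a b; rewrite /entry !mxE. Qed.

Lemma letter_theta q (i : 'I_q.+1) (x u : PGspace R n q) :
  letter (theta i) x u = invmx (entry x i) *m entry u i.
Proof.
apply/matrixP => a b; rewrite /letter /theta /maurer_cartan !mxE /pullback.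
by rewrite diff_proj !entry_proj mxE.
Qed.

Lemma has_mxderive_entry m (i : 'I_m) (x : tuples R n m) :
  has_mxderive (fun y => entry y i) x (fun u => entry u i).
Proof.
have coord_derive (p : tuples R n m -> 'M[R]_(m, n * n)) k :
    linear p -> continuous p ->
    differentiable (fun y => p y i k : R^o) x /\
    forall u, 'D_u (fun y => p y i k : R^o) x = p u i k.
  move=> plin pc; pose h y : R^o := p y i k.
  have hlin : linear h by move=> c u w; rewrite /h plin !mxE.
  pose h' : {linear tuples R n m -> R^o} :=
    HB.pack h (GRing.isLinear.Build _ _ _ _ h hlin).
  have hc : continuous h'.
    by move=> y; exact: cvg_comp (pc y) (@coord_continuous _ _ _ i k (p y)).
  have dh : differentiable h x by exact: (linear_differentiable x hc).
  by split=> // u; rewrite deriveE// -[LHS]/('d h' x u) (diff_lin _ hc).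
move=> a b; pose k := mxvec_index a b.
have [|y|dr Dr] := @coord_derive fst k; first by move=> c [? ?] [? ?].
  exact: cvg_fst.
have [|y|dj Dj] := @coord_derive snd k; first by move=> c [? ?] [? ?].
  exact: cvg_snd.
have rE : (fun y => complex.Re (entry y i a b) : R^o) = fun y => y.1 i k.
  by apply/funext => y; rewrite mxE.
have jE : (fun y => complex.Im (entry y i a b) : R^o) = fun y => y.2 i k.
  by apply/funext => y; rewrite mxE.
split=> [|u]; first by rewrite /cdifferentiable rE jE.
by rewrite /cderive rE jE Dr Dj mxE.
Qed.

(** Invertibility means that the real or the imaginary part of the determinant does
    not vanish. *)
Lemma open_PG q : open (PG R n q).
Proof.
rewrite openE => x PGx; suff : \forall y \near x, forall i, entry y i \in unitmx by [].
have Fx : Filter (nbhs x) by exact: nbhs_filter.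
have := @filter_forall _ _ (fun i (y : PGspace R n q) => entry y i \in unitmx) _ Fx.
apply => i.
pose D (y : PGspace R n q) : R[i] := \det (entry y i).
have [dr dj] : cdifferentiable D x.
  by apply: cdifferentiable_det => a b; exact: (has_mxderive_entry i x a b).1.
have Dx : D x != 0 by rewrite -unitfE; exact: PGx.
have nz (g : PGspace R n q -> R^o) : differentiable g x -> g x != 0 ->
    \near x, g x != 0.
  move=> /differentiable_continuous gc gx0.
  exact: (cvgr_neq0 (g x) gc gx0).
have [r0|j0] : complex.Re (D x) != 0 \/ complex.Im (D x) != 0.
  by move: Dx; rewrite eq_complex negb_and => /orP.
- apply: filterS (nz _ dr r0) => y /= Dy.
  by rewrite unitmxE unitfE; apply: contra Dy; rewrite /D => /eqP ->.
- apply: filterS (nz _ dj j0) => y /= Dy.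
  by rewrite unitmxE unitfE; apply: contra Dy; rewrite /D => /eqP ->.
Qed.

(** Only g^-1 depends on the point in g^-1 dg(v), as dg is the constant linear map
    [entry]. *)
Lemma mc_form_theta q (i : 'I_q.+1) : mc_form (PG R n q) (theta i).
Proof.
split=> [x _ c u w|x Ux v].
  by rewrite !letter_theta entry_is_linear mulmxDr scalemxAr.
have cst : has_mxderive (fun=> entry v i) x (fun=> 0).
  move=> a b; apply: eq_has_cderive (has_cderive_cst _ _) => u.
  by rewrite mxE.
have nU : \near x, entry x i \in unitmx
    by exact: (near_open (@open_PG q) Ux (fun y PGy => PGy i)).
have dI := has_mxderiveM (has_mxderive_inv (has_mxderive_entry i x) nU) cst.
have -> : letter (theta i) ^~ v = fun y => invmx (entry y i) *m entry v i.
  by apply/funext => y; rewrite letter_theta.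
move=> a b; apply: eq_has_cderive (dI a b) => u.
by rewrite !letter_theta mulmx0 addr0 mulNmx !mulmxA.
Qed.

Definition pullbackmx (V W : normedModType R) r (f : V -> W)
  (A : mxform W n r) : mxform V n r := map_mx (pullback f) A.

Lemma pullback_trword (V W : normedModType R) (f : V -> W) k s :
  pullback f (trword k s) = trword k (map (pullbackmx f) s) :> dform V k.
Proof.
apply/funext => x; apply/funext => v; rewrite /pullback /trword.
apply: eq_bigr => t _; congr (_ * \tr _); apply: eq_bigr => l _.
case: (ltnP l (size s)) => ls.
  by rewrite (nth_map 0)//; apply/matrixP => a b; rewrite !mxE.
by rewrite !nth_default ?size_map//; apply/matrixP => a b; rewrite !mxE.
Qed.

Lemma pullback_theta q (i : 'I_q.+2) (j : 'I_q.+1) :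
  pullbackmx (face i) (theta j : mxform (PGspace R n q) n 1) = theta (lift i j).
Proof.
apply/matrixP => a b; apply/funext => x; apply/funext => v.
by rewrite !mxE /pullback !diff_proj diff_face !entry_proj !entry_face.
Qed.

End SimplicialForms.

(** * Multilinear functions on cyclic words *)

Section CyclicIdentities.
Variables (K : numFieldType) (E : zmodType).

(** In odd length rotations preserve T; up to rotation the mixed words in two
    letters are the six displayed ones, and the five rotations of each of them
    occur with the same sign. *)
Lemma cyclic5_expand (T : E -> E -> E -> E -> E -> K) :
  (forall a b c d e, T a b c d e = T b c d e a) ->
  (forall a a' b c d e, T (a - a') b c d e = T a b c d e - T a' b c d e) ->
  forall a b, T (a - b) (a - b) (a - b) (a - b) (a - b) =
    T a a a a a - T b b b b b
    + 5 * (T a a a b b - T a a a a b + T a a b a b - T a b a b b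
           + T a b b b b - T a a b b b).
Proof.
move=> rot sub1 a b.
have sub2 u x y v w z : T u (x - y) v w z = T u x v w z - T u y v w z.
  by rewrite rot sub1 -!(rot u).
have sub3 u x y v w z : T u v (x - y) w z = T u v x w z - T u v y w z.
  by rewrite rot sub2 -!(rot u).
have sub4 u x y v w z : T u v w (x - y) z = T u v w x z - T u v w y z.
  by rewrite rot sub3 -!(rot u).
have sub5 u x y v w z : T u v w z (x - y) = T u v w z x - T u v w z y.
  by rewrite rot sub4 -!(rot u).
rewrite !(sub1, sub2, sub3, sub4, sub5).
(* on constant words the rotation rule would loop *)
set A := T a a a a a; set B := T b b b b b; move: A B => A B.
have to_front u v w z : T u v w z a = T a u v w z by rewrite (rot a).
(* with the constant words hidden behind A and B, both rules terminate: they
   rotate every word until it starts with a and ends with b *)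
rewrite !(rot b) !to_front.
rewrite [T a b a a b]rot [T a b b a b]rot !(rot b).
ring.
Qed.

(** In even length rotations change the sign of T.  On the right, the
    terms in P form a coboundary, and the terms in Q are the words containing all
    three letters: they are, up to sign, the differentials of the words abc and acb. *)
Lemma cyclic4_expand (T : E -> E -> E -> E -> K) :
  (forall a b c d, T a b c d = - T b c d a) ->
  (forall a a' b c d, T (a - a') b c d = T a b c d - T a' b c d) ->
  forall a b c, let x := a - b in let y := b - c in
  let P u v := 2^-1 * T u u u v - 4^-1 * T u v u v + 2^-1 * T u v v v in
  let Q u v w := T u u v w - T u v v w + T u v w w in
  2^-1 * T x x x y + 4^-1 * T x y x y + 2^-1 * T x y y y =
  P b c - P a c + P a b + 2^-1 * Q a b c - 2^-1 * Q a c b.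
Proof.
move=> rot sub1 a b c x y P Q; rewrite {}/x {}/y {}/P {}/Q.
have sub2 u x y v w : T u (x - y) v w = T u x v w - T u y v w.
  by rewrite !(rot u) sub1 opprD.
have sub3 u x y v w : T u v (x - y) w = T u v x w - T u v y w.
  by rewrite !(rot u) sub2 opprD.
have sub4 u x y v w : T u v w (x - y) = T u v w x - T u v w y.
  by rewrite !(rot u) sub3 opprD.
(* an odd rotation fixes the constant word and changes the sign *)
have diag u : T u u u u = 0 by apply/eqP; rewrite -eqNr -rot.
rewrite !(sub1, sub2, sub3, sub4) !diag.
rewrite [T b c a b]rot [T b c a c]rot !(rot b b a) !(rot c a) !(rot b a).
rewrite [T a c a b]rot [T c a b a]rot.
rewrite [T b b b c]rot [T b b c b]rot [T b b c c]rot.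
by field.
Qed.

(** F is the cyclic alternating part of T, and the right-hand side is, up to sign,
    its coboundary. *)
Lemma cyclic3_expand (T : E -> E -> E -> K) :
  (forall a b c, T a b c = T b c a) ->
  (forall a a' b c, T (a - a') b c = T a b c - T a' b c) ->
  forall a b c d, let x := a - b in let y := b - c in let z := c - d in
  let F u v w := 2^-1 * T u v w - 2^-1 * T u w v in
  F x y z = F a b c - F a b d + F a c d - F b c d.
Proof.
move=> rot sub1 a b c d x y z F; rewrite {}/F {}/x {}/y {}/z.
have sub2 u x y v : T u (x - y) v = T u x v - T u y v.
  by rewrite !(rot u) sub1.
have sub3 u x y v : T u v (x - y) = T u v x - T u v y.
  by rewrite !(rot u) sub2.
rewrite !(sub1, sub2, sub3) [T b b c]rot [T b c b]rot [T b b d]rot [T b d b]rot.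
rewrite [T b c c]rot [T c c b]rot.
by field.
Qed.
End CyclicIdentities.

(** * The Chern-Simons form of the third Chern character *)

Section ThirdChernCharacter.
Context {R : realType} {n : nat}.

(** The derivative is additive only on differentiable functions, which the
    components of a form on U are at the points of U. *)
Lemma extd_lin (V : normedModType R) (U : set V) r (c : R[i])
    (omega eta : dform V r) x v : U x -> is_form U omega -> is_form U eta ->
  extd (c *: omega + eta) x v = c * extd omega x v + extd eta x v.
Proof.
move=> Ux [_ _ so] [_ _ se]; rewrite /extd mulr_sumr -big_split.
apply: eq_bigr => i _ /=; rewrite mulrCA -mulrDr; congr (_ * _).
have cd (f : dform V r) (w : 'I_r -> V) :
    (forall v : 'I_r -> V, smooth U (fun y => complex.Re (f y v) : R^o) /\
       smooth U (fun y => complex.Im (f y v) : R^o)) ->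
    cdifferentiable (f ^~ w) x.
  by move=> sf; split; [exact: ((sf w).1 1%N).1 | exact: ((sf w).2 1%N).1].
have := has_cderiveD
  (has_cderiveM (has_cderive_cst c x) (cdifferentiableP (cd _ (v \o lift i) so)))
  (cdifferentiableP (cd _ (v \o lift i) se)).
by move=> [_ ->]; rewrite mul0r add0r.
Qed.

Lemma extd0 (V : normedModType R) r : extd (0 : dform V r) = 0.
Proof.
apply/funext => x; apply/funext => v; rewrite /extd big1// => i _.
by rewrite (has_cderive_cst 0 x).2 mulr0.
Qed.

Lemma d'0 q r : d' (0 : dform (PGspace R n q) r) = 0.
Proof. by rewrite /d' big1// => i _; rewrite -[RHS](scaler0 _ ((-1) ^+ i)). Qed.

Lemma d''0 q r : d'' (0 : dform (PGspace R n q) r) = 0.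
Proof. by rewrite /d'' extd0 scaler0. Qed.

Local Notation th i := (theta (inord i)).

Lemma pullback_th q (i : 'I_q.+2) j : (j <= q)%N ->
  pullbackmx (face i) (th j : mxform (PGspace R n q) n 1) = th (bump i j).
Proof.
move=> jq; rewrite pullback_theta; congr theta; apply/val_inj.
rewrite /= !inordK ?ltnS//; exact: leq_add (leq_b1 _) jq.
Qed.

Lemma wedge_cons k (V : normedModType R) (A : mxform V n 1)
    (s : seq (mxform V n 1)) :
  mxwedge A (word k s) = word k.+1 (A :: s).
Proof. by rewrite {1}(word1 A) (@word_cat _ _ _ 1). Qed.

Lemma wedge_rcons k (V : normedModType R) (A : mxform V n 1)
    (s : seq (mxform V n 1)) : size s = k ->
  mxwedge (word k s) A = word (k + 1) (rcons s A).
Proof. by move=> sk; rewrite {1}(word1 A) word_cat// cats1. Qed.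

Lemma mxpow_word k (V : normedModType R) (A : mxform V n 1) :
  mxpow A k = word k (nseq k A).
Proof.
elim: k => [|k IH] /=; last by rewrite IH wedge_cons.
apply/matrixP => a b; apply/funext => x; apply/funext => v.
rewrite mxE wordE (big_pred1 1%g) => [|t]; last first.
  by apply/esym/eqP/permP => -[].
by rewrite big_ord0 odd_perm1 scale1r mxE.
Qed.

Section ShortWords.
Context {V : normedModType R}.
Implicit Types A B C : mxform V n 1.

Lemma wedge3 A B C : mxwedge (mxwedge A B) C = word 3 [:: A; B; C].
Proof. by rewrite [X in mxwedge X B]word1 (@wedge_rcons 1)// (@wedge_rcons 2). Qed.

Lemma wedge4 A B C D :
  mxwedge (mxwedge (mxwedge A B) C) D = word 4 [:: A; B; C; D].
Proof. by rewrite wedge3 (@wedge_rcons 3). Qed.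

Lemma wedge_cube_l A B : mxwedge (mxpow A 3) B = word 4 [:: A; A; A; B].
Proof. by rewrite mxpow_word (@wedge_rcons 3). Qed.

Lemma wedge_cube_r A B : mxwedge A (mxpow B 3) = word 4 [:: A; B; B; B].
Proof. by rewrite mxpow_word wedge_cons. Qed.

End ShortWords.

Definition th_words q (w : seq nat) : seq (mxform (PGspace R n q) n 1) :=
  [seq th j | j <- w].

(** Linear combinations of traces of words in the theta_j, a word being recorded by
    the numbers of its letters.  This makes d' and d'' computable. *)
Definition wordsum q k (l : seq (R[i] * seq nat)) : dform (PGspace R n q) k :=
  \sum_(p <- l) p.1 *: trword k (th_words q p.2).

Arguments wordsum q k l : clear implicits.

Lemma mc_form_th_words q w (l : 'I_(size w)) :
  mc_form (PG R n q) (th_words q w)`_l.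
Proof. by rewrite (nth_map 0%N)//; exact: mc_form_theta. Qed.

Lemma is_form_wordsum q k (l : seq (R[i] * seq nat)) :
  all (fun p => size p.2 == k) l ->
  is_form (PG R n q) (wordsum q k l).
Proof.
rewrite /wordsum; elim: l => [_|[c w] l IH /= /andP[/eqP wk /IH lk]].
  by rewrite big_nil; exact/is_form0/open_PG.
rewrite big_cons /=; apply: is_form_lin => //; first exact: open_PG.
rewrite -wk; apply: is_form_trword; first exact: open_PG.
exact: mc_form_th_words.
Qed.

Lemma extd_wordsum q k (l : seq (R[i] * seq nat)) x
    (v : 'I_k.+1 -> PGspace R n q) : PG R n q x ->
  all (fun p => size p.2 == k) l ->
  extd (wordsum q k l) x v = \sum_(p <- l) p.1 * - \sum_(j < k) (-1) ^+ j *
    trword k.+1 (th_words q (take j.+1 p.2 ++ drop j p.2)) x v.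
Proof.
move=> PGx; elim: l => [_|[c w] l IH lk].
  by rewrite /wordsum !big_nil extd0.
have /= /andP[/eqP wk lk'] := lk.
rewrite /wordsum !big_cons /= (extd_lin (U := PG R n q))//; last first.
- exact: is_form_wordsum.
- rewrite -wk; apply: is_form_trword; first exact: open_PG.
  exact: mc_form_th_words.
rewrite (extd_trword (U := PG R n q))// ?size_map//; last first.
  by rewrite -wk; exact: mc_form_th_words.
rewrite -/(wordsum _ _ _) IH//; congr (_ * - _ + _); apply: eq_bigr => j _.
by rewrite /th_words map_cat map_take map_drop.
Qed.

Lemma d'_wordsum q k (l : seq (R[i] * seq nat)) :
  all (fun p => all (leq^~ q) p.2) l ->
  d' (wordsum q k l) = \sum_(i < q.+2)
    wordsum q.+1 k [seq ((-1) ^+ i * p.1, map (bump i) p.2) | p <- l].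
Proof.
move=> lq; apply: eq_bigr => i _; elim: l lq => [_|[c w] l IH /= /andP[wq lq]].
  rewrite /wordsum !big_nil -[LHS]/((-1) ^+ i *: 0); exact: scaler0.
have wE : map (pullbackmx (face i)) (th_words q w) = th_words q.+1 (map (bump i) w).
  rewrite /th_words -!map_comp; apply/eq_in_map => j jw /=.
  by rewrite pullback_th// (allP wq).
rewrite {1}/wordsum big_cons -/(wordsum q k l) [RHS]/wordsum /= big_cons.
rewrite -/(wordsum q.+1 k _) -IH// -wE -pullback_trword -scalerA -scalerDr.
by [].
Qed.

Local Notation cc := (ch3_coef R).

Lemma TC05E : TC05 R n = wordsum 0 5 [:: (- cc / 10, nseq 5 0%N)].
Proof.
by rewrite /TC05 mxpow_word trform_word scalerA /wordsum big_seq1.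
Qed.

Lemma TC14E : TC14 R n = wordsum 1 4
  [:: (- cc / 2, [:: 0; 0; 0; 1]); (cc / 4, [:: 0; 1; 0; 1]);
      (- cc / 2, [:: 0; 1; 1; 1])]%N.
Proof.
rewrite /TC14 /wordsum !big_cons big_nil /=; move: (th 0) (th 1) => A B.
rewrite (wedge_cube_l A B) (wedge4 A B A B) (wedge_cube_r A B) !trform_word.
rewrite !scalerDr scalerN !scalerA !mulNr -[X in _ + X + _]scaleNr opprK addr0.
by rewrite -addrA.
Qed.

Lemma TC23E : TC23 R n = wordsum 2 3
  [:: (cc / 2, [:: 0; 1; 2]); (- cc / 2, [:: 0; 2; 1])]%N.
Proof.
rewrite /TC23 /wordsum !big_cons big_nil /=; move: (th 0) (th 1) (th 2) => A B C.
rewrite (wedge3 A B C) (wedge3 A C B) !trform_word.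
by rewrite !scalerDr scalerN -scaleNr !scalerA mulNr addr0.
Qed.

Lemma wordsumE q k l x v : wordsum q k l x v =
  \sum_(p <- l) p.1 * trword k (th_words q p.2) x v.
Proof. by rewrite /wordsum sum_dformE. Qed.

(** The word theta_0^6 has even length, so rotating it shows that its trace is its
    own opposite. *)
Lemma d''_TC05 x v : PG R n 0 x -> d'' (TC05 R n) x v = 0.
Proof.
move=> PGx; rewrite /d'' TC05E expr0 scale1r extd_wordsum// big_seq1 /=.
rewrite !big_ord_recl big_ord0 /th_words /=.
set W := trword _ _ _ _.
have W0 : W = 0 by apply/eqP; rewrite -eqNr {2}/W trword_rot// -signr_odd mulN1r.
by rewrite W0 !mulr0 !addr0 oppr0 mulr0.
Qed.

Lemma d'TC05_d''TC14 x v : PG R n 1 x ->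
  (d' (TC05 R n) + d'' (TC14 R n)) x v = C15 R n x v.
Proof.
move=> PGx.
rewrite -[LHS]/(d' (TC05 R n) x v + (-1) ^+ 1 * extd (TC14 R n) x v).
rewrite TC05E d'_wordsum// TC14E extd_wordsum// sum_dformE.
rewrite !(big_cons, big_nil, big_ord_recl, big_ord0, wordsumE) /th_words /= /bump /=.
rewrite /C15 mxpow_word trform_word.
rewrite -[RHS]/(cc * (10^-1 * trword 5 (nseq 5 (theta_sub R n 1 0)) x v)) /=.
have rot (a b c d e : mxform (PGspace R n 1) n 1) :
    trword 5 [:: a; b; c; d; e] x v =
    trword 5 [:: b; c; d; e; a] x v.
  by rewrite trword_rot//= -signr_odd mul1r.
rewrite (cyclic5_expand (T := fun a b c d e => trword 5 [:: a; b; c; d; e] x v))//;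
  last by move=> *; exact: trwordB.
rewrite ?addn0 ?add0n; move: (th 0) (th 1) => a b.
rewrite (rot a b a a b) (rot a b b a b) (rot b b a b a) (rot b a a b a).
rewrite (rot b a b a b).
(* [field] sees the traces of words as opaque variables *)
repeat (move: (trword 5 _ x v) => ?); move: cc => c.
by field.
Qed.

Lemma C24E x v : let y := theta_sub R n 2 0 in let z := theta_sub R n 2 1 in
  C24 R n x v = - cc * (2^-1 * trword 4 [:: y; y; y; z] x v +
   4^-1 * trword 4 [:: y; z; y; z] x v + 2^-1 * trword 4 [:: y; z; z; z] x v).
Proof.
rewrite /C24; move: (theta_sub R n 2 0) (theta_sub R n 2 1) => y z /=.
by rewrite (wedge_cube_l y z) (wedge4 y z y z) (wedge_cube_r y z) !trform_word.
Qed.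

Lemma C33E x v : let y := theta_sub R n 3 0 in let z := theta_sub R n 3 1 in
  let w := theta_sub R n 3 2 in
  C33 R n x v = - cc * (2^-1 * trword 3 [:: y; z; w] x v -
   2^-1 * trword 3 [:: y; w; z] x v).
Proof.
rewrite /C33; move: (theta_sub R n 3 0) (theta_sub R n 3 1) (theta_sub R n 3 2).
by move=> y z w /=; rewrite (wedge3 y z w) (wedge3 y w z) !trform_word.
Qed.

Lemma d'TC14_d''TC23 x v : PG R n 2 x ->
  (d' (TC14 R n) + d'' (TC23 R n)) x v = C24 R n x v.
Proof.
move=> PGx.
rewrite -[LHS]/(d' (TC14 R n) x v + (-1) ^+ 2 * extd (TC23 R n) x v).
rewrite TC14E d'_wordsum// TC23E extd_wordsum// sum_dformE.
rewrite !(big_cons, big_nil, big_ord_recl, big_ord0, wordsumE) /th_words /= /bump /=.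
rewrite C24E /theta_sub.
have rot (a b c d : mxform (PGspace R n 2) n 1) :
    trword 4 [:: a; b; c; d] x v = - trword 4 [:: b; c; d; a] x v.
  by rewrite trword_rot//= -signr_odd mulN1r.
rewrite (cyclic4_expand (T := fun a b c d => trword 4 [:: a; b; c; d] x v))//;
  last by move=> *; exact: trwordB.
rewrite ?addn0 ?add0n ?addn1; move: (th 0) (th 1) (th 2) => a b c.
(* [field] sees the traces of words as opaque variables *)
repeat (move: (trword 4 _ x v) => ?); move: cc => k.
by field.
Qed.

Lemma d'_TC23 x v : d' (TC23 R n) x v = C33 R n x v.
Proof.
rewrite TC23E d'_wordsum// sum_dformE.
rewrite !(big_cons, big_nil, big_ord_recl, big_ord0, wordsumE) /th_words /= /bump /=.
rewrite C33E /theta_sub.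
have rot (a b c : mxform (PGspace R n 3) n 1) :
    trword 3 [:: a; b; c] x v = trword 3 [:: b; c; a] x v.
  by rewrite trword_rot//= -signr_odd mul1r.
rewrite (cyclic3_expand (T := fun a b c => trword 3 [:: a; b; c] x v))//;
  last by move=> *; exact: trwordB.
rewrite ?addn0 ?add0n ?addn1; move: (th 0) (th 1) (th 2) (th 3) => a b c d.
(* [field] sees the traces of words as opaque variables *)
repeat (move: (trword 3 _ x v) => ?); move: cc => k.
by field.
Qed.

Lemma is_form_transgression q r : is_form (PG R n q) (ch3_transgression R n q r).
Proof.
have f0 q' r' : is_form (PG R n q') (0 : dform (PGspace R n q') r').
  exact/is_form0/open_PG.
case: q => [|[|[|q]]] /=; last exact: f0.
- by do 6?[case: r => [|r] /=; try exact: f0]; rewrite TC05E; exact: is_form_wordsum.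
- by do 5?[case: r => [|r] /=; try exact: f0]; rewrite TC14E; exact: is_form_wordsum.
- by do 4?[case: r => [|r] /=; try exact: f0]; rewrite TC23E; exact: is_form_wordsum.
Qed.

End ThirdChernCharacter.

Theorem theorem3p6 (R : realType) (n : nat) :
  is_chern_simons 5 (ch3_cocycle R n) (ch3_transgression R n) /\
  [/\ {in PG R n 0, d'' (TC05 R n) =1 (0 : dform _ 6)},
      {in PG R n 1, d' (TC05 R n) + d'' (TC14 R n) =1 C15 R n},
      {in PG R n 2, d' (TC14 R n) + d'' (TC23 R n) =1 C24 R n}
    & {in PG R n 3, d' (TC23 R n) =1 C33 R n}].
Proof.
have e06 : {in PG R n 0, d'' (TC05 R n) =1 (0 : dform _ 6)}.
  by move=> x /set_mem PGx; apply/funext => v; exact: d''_TC05.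
have e15 : {in PG R n 1, d' (TC05 R n) + d'' (TC14 R n) =1 C15 R n}.
  by move=> x /set_mem PGx; apply/funext => v; exact: d'TC05_d''TC14.
have e24 : {in PG R n 2, d' (TC14 R n) + d'' (TC23 R n) =1 C24 R n}.
  by move=> x /set_mem PGx; apply/funext => v; exact: d'TC14_d''TC23.
have e33 : {in PG R n 3, d' (TC23 R n) =1 C33 R n}.
  by move=> x _; apply/funext => v; exact: d'_TC23.
split; last by split.
split; first split.
- exact: is_form_transgression.
- move=> q r.
  by case: q => [|[|[|q]]]; do 7?[case: r => [|r]].
move=> q r; rewrite /total_d.
have zeroE := (@d'0 R n, @d''0 R n, add0r, addr0).
case: q => [|[|[|[|q]]]].
- by do 7?[case: r => [|r]]; rewrite /= ?zeroE.
- by do 6?[case: r => [|r]]; rewrite /= ?zeroE.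
- by do 5?[case: r => [|r]]; rewrite /= ?zeroE.
- by do 4?[case: r => [|r]]; rewrite /= ?zeroE.
- by case: r => [|r]; rewrite /= !zeroE.
Qed.
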